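(* Let $\mathbf{y}^*$ be a minimizer of $\varphi(\mathbf{y})=\frac12\|\mathbf{f}(\mathbf{y})\|^2+\mathcal{R}(\mathbf{y})$ and let $\Omega\subseteq\mathbb{R}^r$ be an open neighborhood of $\mathbf{y}^*$. Assume that: - there are constants $M>0$, $\kappa>0$, $\gamma>0$ such that $\max_j\left\|\frac{\partial\mathbf{A}(\mathbf{y})}{\partial y_j}\right\|\le M$, $\kappa_2(\mathbf{K}(\mathbf{y}))\le\kappa$, and $\|\mathbf{K}(\mathbf{y})\|\ge\gamma$ for all $\mathbf{y}\in\Omega$; - the Jacobian $\mathbf{J}(\mathbf{y})=\mathbf{J}_{\mathbf{f}}(\mathbf{y})$ of $\mathbf{f}(\mathbf{y})$ is of full rank in $\Omega$ and satisfies $\|\mathbf{J}(\mathbf{y})-\mathbf{J}(\mathbf{y}^* )\|\le L\|\mathbf{y}-\mathbf{y}^*\|$ with a constant $L>0$ for all $\mathbf{y}\in\Omega$; - the regularization term $\mathcal{R}$ is convex and $C^2$, and its Hessian satisfies $\|\nabla^2\mathcal{R}(\mathbf{y})-\nabla^2\mathcal{R}(\mathbf{y}^* )\|\le L_{\mathcal{R}}\|\mathbf{y}-\mathbf{y}^*\|$ for all $\mathbf{y}\in\Omega$. Let $\phi(\mathbf{y})=\frac12\|\mathbf{f}(\mathbf{y})\|^2$, which is assumed twice differentiable at $\mathbf{y}^*$. Then, if $\|\mathbf{H}(\mathbf{y}^* )^{-1}\|\,\|\mathbf{J}(\mathbf{y}^* )^\top\mathbf{J}(\mathbf{y}^* )-\nabla^2\phi(\mathbf{y}^*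 )\|<1/32$ and $\|\mathbf{y}^{(0)}-\mathbf{y}^*\|$ is sufficiently small, one can choose adequate tolerances $\varepsilon^{(k)}>0$ for $k\ge0$ so that the sequence $(\mathbf{y}^{(k)})_{k\ge0}$ generated by the iRGenVarPro method with these tolerances satisfies $\|\mathbf{y}^{(k)}-\mathbf{y}^*\|\le\frac{1}{2^k}$ for every $k\in\mathbb{N}$.
   Context: Here $\mathbf{A}(\mathbf{y})\in\mathbb{R}^{m\times n}$ with $m\ge n$ depends differentiably on the parameter $\mathbf{y}\in\mathbb{R}^r$ (in a set of feasible parameters containing $\Omega$), with $r$ much smaller than $n$; $\mathbf{L}\in\mathbb{R}^{q\times n}$, $\mathbf{b}\in\mathbb{R}^m$, $\lambda>0$ are given; $\mathcal{N}(\mathbf{A}(\mathbf{y}))\cap\mathcal{N}(\mathbf{L})=\{\mathbf{0}\}$ for all feasible $\mathbf{y}$ ($\mathcal{N}$ = null space). $\|\cdot\|$ is the Euclidean norm for vectors and the induced operator norm for matrices. Define $$\mathbf{K}(\mathbf{y})=\begin{bmatrix}\mathbf{A}(\mathbf{y})\\ \lambda\mathbf{L}\end{bmatrix},\quad \mathbf{d}=\begin{bmatrix}\mathbf{b}\\ \mathbf{0}\end{bmatrix},\quad \mathbf{K}(\mathbf{y})^\dagger=(\mathbf{K}(\mathbf{y})^\top\mathbf{K}(\mathbf{y}))^{-1}\mathbf{K}(\mathbf{y})^\top,\quad \mathcal{P}^\perp_{\mathbf{K}(\mathbf{y})}=\mathbf{I}-\mathbf{K}(\mathbf{y})\mathbf{K}(\mathbf{y})^\dagger,$$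 $\mathbf{f}(\mathbf{y})=-\mathcal{P}^\perp_{\mathbf{K}(\mathbf{y})}\mathbf{d}$, $\kappa_2(\mathbf{K})=\|\mathbf{K}\|\|\mathbf{K}^\dagger\|$ (2-norm condition number), $\mathbf{J}_{\mathbf{f}}(\mathbf{y})\in\mathbb{R}^{(m+q)\times r}$ the Jacobian matrix of $\mathbf{f}$, and $\mathbf{H}(\mathbf{y})=\mathbf{J}_{\mathbf{f}}(\mathbf{y})^\top\mathbf{J}_{\mathbf{f}}(\mathbf{y})+\nabla^2\mathcal{R}(\mathbf{y})$. The iRGenVarPro method: given $\mathbf{y}^{(0)}$ and tolerances $\varepsilon^{(k)}>0$, for $k=0,1,2,\dots$: 1. Compute $\bar{\mathbf{x}}^{(k)}$ by applying LSQR to $\min_{\mathbf{x}}\frac12\|\mathbf{K}(\mathbf{y}^{(k)})\mathbf{x}-\mathbf{d}\|^2$, stopping at the first iterate whose residual $\mathbf{r}^{(i)}=\mathbf{K}(\mathbf{y}^{(k)})\mathbf{x}^{(i)}-\mathbf{d}$ satisfies $$\frac{\|\mathbf{K}(\mathbf{y}^{(k)})^\top\mathbf{r}^{(i)}\|}{\|\mathbf{r}^{(i)}\|\,\|\mathbf{K}(\mathbf{y}^{(k)})\|}<\varepsilon^{(k)}$$ (regarded as satisfied if $\mathbf{r}^{(i)}=\mathbf{0}$). In exact arithmetic, LSQR started at zero produces as $i$-th iterate $\mathbf{x}^{(i)}$ the minimizer of $\|\mathbf{K}\mathbf{x}-\mathbf{d}\|$ over the Krylov subspace $\mathrm{span}\{(\mathbf{K}^\top\mathbf{K})^l\mathbf{K}^\top\mathbf{d}:0\le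 l<i\}$, where $\mathbf{K}=\mathbf{K}(\mathbf{y}^{(k)})$. 2. Set $\mathbf{g}^{(k)}=\mathbf{K}(\mathbf{y}^{(k)})\bar{\mathbf{x}}^{(k)}-\mathbf{d}$. 3. Let $\bar{\mathbf{J}}^{(k)}$ be the $(m+q)\times r$ matrix whose $j$-th column is $$\mathcal{P}^\perp_{\mathbf{K}(\mathbf{y}^{(k)})}\begin{bmatrix}\frac{\partial\mathbf{A}}{\partial y_j}(\mathbf{y}^{(k)})\\ \mathbf{0}\end{bmatrix}\bar{\mathbf{x}}^{(k)}+\big(\mathbf{K}(\mathbf{y}^{(k)})^\dagger\big)^\top\Big(\frac{\partial\mathbf{A}}{\partial y_j}(\mathbf{y}^{(k)})\Big)^\top\big(\mathbf{b}-\mathbf{A}(\mathbf{y}^{(k)})\bar{\mathbf{x}}^{(k)}\big),\quad j=1,\dots,r.$$ 4. Set $\bar{\mathbf{H}}^{(k)}=(\bar{\mathbf{J}}^{(k)})^\top\bar{\mathbf{J}}^{(k)}+\nabla^2\mathcal{R}(\mathbf{y}^{(k)})$ and $$\mathbf{y}^{(k+1)}=\mathbf{y}^{(k)}-(\bar{\mathbf{H}}^{(k)})^{-1}\big((\bar{\mathbf{J}}^{(k)})^\top\mathbf{g}^{(k)}+\nabla\mathcal{R}(\mathbf{y}^{(k)})\big).$$ In the theorem the tolerances $\varepsilon^{(k)}$ may be chosen freely (not necessarily by halving). *)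

(* Defs.v *)
From HB Require Import structures.
From mathcomp Require Import all_boot all_order all_algebra.
From mathcomp Require Import all_classical all_reals all_analysis.

Set Implicit Arguments.
Unset Strict Implicit.
Unset Printing Implicit Defensive.

Import Order.TTheory GRing.Theory Num.Theory.
Import numFieldNormedType.Exports.

Local Open Scope classical_set_scope.
Local Open Scope ring_scope.

(* The library norm [`|x|] on matrices is the max norm; it induces the same
   topology as the two norms below, so [open], [differentiable], [continuous]
   and ['D_v] are the library's. *)
Definition norm2 (R : realType) (n : nat) (x : 'cV[R]_n) : R :=
  Num.sqrt (\sum_(i < n) x i 0 ^+ 2).

Definition opnorm (R : realType) (m n : nat) (A : 'M[R]_(m, n)) : R :=
  sup [set norm2 (A *m x) | x in [set x : 'cV[R]_n | norm2 x <= 1]].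

Definition null_space (R : realType) (m n : nat) (A : 'M[R]_(m, n)) :
  set 'cV[R]_n := [set x | A *m x = 0].

Definition partial (R : realType) (r : nat) (W : normedModType R)
    (j : 'I_r) (F : 'cV[R]_r -> W) (y : 'cV[R]_r) : W :=
  'D_(delta_mx j 0 : 'cV[R]_r) F y.

(* The library's [jacobian] is for row vectors and is the transpose of the
   usual matrix of partial derivatives. *)
Definition jacmx (R : realType) (p r : nat) (F : 'cV[R]_r -> 'cV[R]_p)
    (y : 'cV[R]_r) : 'M[R]_(p, r) :=
  \matrix_(i < p, j < r) partial j F y i 0.

Definition grad (R : realType) (r : nat) (g : 'cV[R]_r -> R)
    (y : 'cV[R]_r) : 'cV[R]_r :=
  \col_(j < r) partial j (g : 'cV[R]_r -> R^o) y.

Definition hess (R : realType) (r : nat) (g : 'cV[R]_r -> R) :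
  'cV[R]_r -> 'M[R]_r := jacmx (grad g).

Definition twice_differentiable_at (R : realType) (r : nat)
    (g : 'cV[R]_r -> R) (y : 'cV[R]_r) : Prop :=
  (\forall z \near y, differentiable (g : 'cV[R]_r -> R^o) z) /\
  differentiable (grad g) y.

Definition C2 (R : realType) (r : nat) (g : 'cV[R]_r -> R) : Prop :=
  (forall y, twice_differentiable_at g y) /\ continuous (hess g).

Definition pinv (R : realType) (p n : nat) (K : 'M[R]_(p, n)) : 'M[R]_(n, p) :=
  invmx (K^T *m K) *m K^T.

Definition proj_perp (R : realType) (p n : nat) (K : 'M[R]_(p, n)) :
  'M[R]_p := 1%:M - K *m pinv K.

Definition cond2 (R : realType) (p n : nat) (K : 'M[R]_(p, n)) : R :=
  opnorm K * opnorm (pinv K).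

Definition Kmx (R : realType) (m n q r : nat) (A : 'cV[R]_r -> 'M[R]_(m, n))
    (L : 'M[R]_(q, n)) (lambda : R) (y : 'cV[R]_r) : 'M[R]_(m + q, n) :=
  col_mx (A y) (lambda *: L).

Definition dvec (R : realType) (m q : nat) (b : 'cV[R]_m) : 'cV[R]_(m + q) :=
  col_mx b 0.

Definition residual (R : realType) (m n q r : nat)
    (A : 'cV[R]_r -> 'M[R]_(m, n)) (L : 'M[R]_(q, n)) (b : 'cV[R]_m)
    (lambda : R) (y : 'cV[R]_r) : 'cV[R]_(m + q) :=
  - (proj_perp (Kmx A L lambda y) *m dvec q b).

(* [span {(K^T K)^l K^T d : 0 <= l < i}]; it is [{0}] for [i = 0]. *)
Definition krylov (R : realType) (p n : nat) (K : 'M[R]_(p, n)) (d : 'cV[R]_p)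
    (i : nat) : {vspace 'cV[R]_n} :=
  <<[seq (K^T *m K) ^+ l *m (K^T *m d) | l <- iota 0 i]>>%VS.

(* The LSQR iterates in exact arithmetic from a zero initial guess, the guess
   itself being iterate 0. *)
Definition lsqr_iterate (R : realType) (p n : nat) (K : 'M[R]_(p, n))
    (d : 'cV[R]_p) (i : nat) (x : 'cV[R]_n) : Prop :=
  x \in krylov K d i /\
  (forall z, z \in krylov K d i -> norm2 (K *m x - d) <= norm2 (K *m z - d)).

Definition stopping_test (R : realType) (p n : nat) (K : 'M[R]_(p, n))
    (d : 'cV[R]_p) (eps : R) (x : 'cV[R]_n) : Prop :=
  let res := K *m x - d in
  res = 0 \/ norm2 (K^T *m res) / (norm2 res * opnorm K) < eps.

Definition lsqr_output (R : realType) (p n : nat) (K : 'M[R]_(p, n))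
    (d : 'cV[R]_p) (eps : R) (x : 'cV[R]_n) : Prop :=
  exists i : nat,
    [/\ lsqr_iterate K d i x, stopping_test K d eps x
      & forall (i' : nat) (x' : 'cV[R]_n), (i' < i)%N ->
          lsqr_iterate K d i' x' -> ~ stopping_test K d eps x'].

Definition approx_jac (R : realType) (m n q r : nat)
    (A : 'cV[R]_r -> 'M[R]_(m, n)) (L : 'M[R]_(q, n)) (b : 'cV[R]_m)
    (lambda : R) (y : 'cV[R]_r) (x : 'cV[R]_n) : 'M[R]_(m + q, r) :=
  let K := Kmx A L lambda y in
  \matrix_(i < m + q, j < r)
    (proj_perp K *m col_mx (partial j A y) (0 : 'M[R]_(q, n)) *m x
     + (pinv K)^T *m (partial j A y)^T *m (b - A y *m x)) i 0.

(* One outer iteration, from [y] to [y'], with tolerance [eps].  It is a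
   relation because it is undefined when the matrix [H] is singular. *)
Definition iRGenVarPro_step (R : realType) (m n q r : nat)
    (A : 'cV[R]_r -> 'M[R]_(m, n)) (L : 'M[R]_(q, n)) (b : 'cV[R]_m)
    (lambda : R) (Reg : 'cV[R]_r -> R) (eps : R) (y y' : 'cV[R]_r) : Prop :=
  let K := Kmx A L lambda y in
  let d := dvec q b in
  exists2 x : 'cV[R]_n, lsqr_output K d eps x &
    let g := K *m x - d in
    let J := approx_jac A L b lambda y x in
    let H := J^T *m J + hess Reg y in
    H \in unitmx /\ y' = y - invmx H *m (J^T *m g + grad Reg y).

Definition iRGenVarPro (R : realType) (m n q r : nat)
    (A : 'cV[R]_r -> 'M[R]_(m, n)) (L : 'M[R]_(q, n)) (b : 'cV[R]_m)
    (lambda : R) (Reg : 'cV[R]_r -> R) (eps : nat -> R) (y0 : 'cV[R]_r)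
    (y : nat -> 'cV[R]_r) : Prop :=
  y 0%N = y0 /\
  forall k, iRGenVarPro_step A L b lambda Reg (eps k) (y k) (y k.+1).

(* Main.v *)
Require Import Defs.
From HB Require Import structures.
From mathcomp Require Import all_boot all_order all_algebra.
From mathcomp Require Import all_classical all_reals all_analysis.
From mathcomp Require Import ring lra.

Set Implicit Arguments.
Unset Strict Implicit.
Unset Printing Implicit Defensive.

Import Order.TTheory GRing.Theory Num.Theory.
Import numFieldNormedType.Exports.
(* Below, [pinv] is the Moore-Penrose inverse of a matrix of full column rank,
   not the partial inverse of a function. *)
Import Defs.

Local Open Scope classical_set_scope.
Local Open Scope ring_scope.

(** The tolerance of an outer step is chosen after the current parameter y is
    known, and this makes the inexact method collapse to an exact one.  As K(y)
    has full column rank, LSQR has one well-defined iterate for every i and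
    reaches the least squares solution pinv K *m d at i = n at the latest, by
    the Cayley-Hamilton theorem.  The stopping ratio is zero only there, so a
    tolerance below the finitely many positive ratios of the iterates before n
    accepts nothing but pinv K *m d ([lsqr_exact]).  At that point the residual
    g of the method is f(y) and the approximate Jacobian is the Jacobian of f
    ([jacmx_residual], the Golub-Pereyra formula), so the outer step is exactly
    the Gauss-Newton step
      y' = y - (J^T J + hess Reg)^-1 (J^T f + grad Reg)
    ([iRGenVarPro_step_exact]).

    It remains to see that Gauss-Newton contracts distances to ystar by 1/2
    near ystar.  Its right-hand side is G = grad phi + grad Reg, because
    grad phi = J^T f ([grad_half_norm2_sqr]).  G vanishes at the minimizer, is
    differentiable there, and its Jacobian differs from H(ystar) by
    J^T J - hess phi, the quantity that the smallness hypothesis controls.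
    H(ystar) is invertible since J has full column rank and the Hessian of the
    convex function Reg is positive semidefinite ([convex_hess_ge0]), and H is
    continuous at ystar.  From
      H(y) (y' - ystar) = (H(y) - H(ystar)) (y - ystar)
        + (H(ystar) - DG(ystar)) (y - ystar)
        - (G(y) - G(ystar) - DG(ystar) (y - ystar))
    the contraction follows ([newton_contraction]): the first and last terms
    are o(|y - ystar|), the middle one is bounded by hypothesis, and H(y)^-1 is
    bounded by twice the norm of H(ystar)^-1.  Starting within distance 1 of
    ystar gives |y_k - ystar| <= 2^-k. *)

(** * Euclidean norm and operator norm *)

Section EuclideanNorm.
Context {R : realType}.

Lemma norm2_sqr n (x : 'cV[R]_n) : norm2 x ^+ 2 = (x^T *m x) 0 0.
Proof.
rewrite /norm2 sqr_sqrtr; last by apply: sumr_ge0 => i _; exact: sqr_ge0.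
by rewrite mxE; apply: eq_bigr => i _; rewrite mxE expr2.
Qed.

Lemma norm2_ge0 n (x : 'cV[R]_n) : 0 <= norm2 x.
Proof. exact: sqrtr_ge0. Qed.

Lemma norm2_le_sqr n p (x : 'cV[R]_n) (y : 'cV[R]_p) :
  (norm2 x <= norm2 y) = (norm2 x ^+ 2 <= norm2 y ^+ 2).
Proof. by rewrite ler_pXn2r ?nnegrE ?norm2_ge0. Qed.

Lemma norm2_eq0 n (x : 'cV[R]_n) : (norm2 x == 0) = (x == 0).
Proof.
rewrite -[LHS](expf_eq0 _ 2%N) norm2_sqr mxE psumr_eq0; last first.
  by move=> i _; rewrite mxE -expr2 sqr_ge0.
apply/allP/eqP => [x0|-> i _]; last by rewrite !mxE mul0r eqxx.
apply/colP => i; apply/eqP; have := x0 i (mem_index_enum i).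
by rewrite !mxE mulf_eq0 orbb.
Qed.

Lemma norm20 n : norm2 (0 : 'cV[R]_n) = 0.
Proof. by apply/eqP; rewrite norm2_eq0. Qed.

Lemma norm2N n (x : 'cV[R]_n) : norm2 (- x) = norm2 x.
Proof. by congr Num.sqrt; apply: eq_bigr => i _; rewrite mxE sqrrN. Qed.

Lemma norm2Z n (a : R) (x : 'cV[R]_n) : norm2 (a *: x) = `|a| * norm2 x.
Proof.
rewrite /norm2 -sqrtr_sqr -sqrtrM ?sqr_ge0// mulr_sumr; congr Num.sqrt.
by apply: eq_bigr => i _; rewrite mxE exprMn.
Qed.

Lemma dotC n (x y : 'cV[R]_n) : (x^T *m y) 0 0 = (y^T *m x) 0 0.
Proof. by rewrite -[in LHS](trmxK y) -trmx_mul mxE. Qed.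

Lemma norm2D_sqr n (x y : 'cV[R]_n) :
  norm2 (x + y) ^+ 2 = norm2 x ^+ 2 + (x^T *m y) 0 0 *+ 2 + norm2 y ^+ 2.
Proof.
rewrite !norm2_sqr mulmxDr linearD/= !mulmxDl.
rewrite [LHS]mxE [X in X + _]mxE [X in _ + X]mxE [(y^T *m x) 0 0]dotC.
by rewrite mulr2n !addrA.
Qed.

(** Expand the square of the norm of |y| x - |x| y. *)
Lemma cauchy_schwarz n (x y : 'cV[R]_n) : (x^T *m y) 0 0 <= norm2 x * norm2 y.
Proof.
have [->|x0] := eqVneq x 0.
  by rewrite trmx0 mul0mx mxE norm20 mul0r.
have [->|y0] := eqVneq y 0.
  by rewrite mulmx0 mxE norm20 mulr0.
have nx : 0 < norm2 x by rewrite lt_def norm2_eq0 x0 norm2_ge0.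
have ny : 0 < norm2 y by rewrite lt_def norm2_eq0 y0 norm2_ge0.
have := sqr_ge0 (norm2 (norm2 y *: x + (- norm2 x) *: y)).
rewrite norm2D_sqr !norm2Z normrN !ger0_norm ?norm2_ge0//.
rewrite -scalemxAr linearZ/= -scalemxAl 2!mxE.
set a := norm2 x in nx *; set c := norm2 y in ny *; set d := (_ *m _) 0 0.
rewrite [leRHS](_ : _ = (a * c) * ((a * c - d) *+ 2)); last by ring.
by rewrite pmulr_rge0 ?mulr_gt0// pmulrn_lge0// subr_ge0.
Qed.

Lemma norm2D n (x y : 'cV[R]_n) : norm2 (x + y) <= norm2 x + norm2 y.
Proof.
rewrite -(@ler_pXn2r _ 2)// ?nnegrE ?addr_ge0 ?norm2_ge0// norm2D_sqr sqrrD.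
by rewrite lerD2r lerD2l lerMn2r cauchy_schwarz orbT.
Qed.

Lemma norm2B n (x y : 'cV[R]_n) : norm2 (x - y) <= norm2 x + norm2 y.
Proof. by rewrite -[norm2 y]norm2N norm2D. Qed.

Lemma coord_le_norm2 n (x : 'cV[R]_n) i : `|x i 0| <= norm2 x.
Proof.
rewrite -(@ler_pXn2r _ 2)// ?nnegrE ?norm2_ge0// real_normK ?num_real//.
rewrite norm2_sqr mxE (bigD1 i)//= mxE -expr2 lerDl sumr_ge0// => j _.
by rewrite mxE -expr2 sqr_ge0.
Qed.

Lemma norm2_le_sum n (x : 'cV[R]_n) : norm2 x <= \sum_i `|x i 0|.
Proof.
have s0 : 0 <= \sum_i `|x i 0| by apply: sumr_ge0.
rewrite -(@ler_pXn2r _ 2)// ?nnegrE ?norm2_ge0// norm2_sqr mxE expr2 mulr_suml.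
apply: ler_sum => i _; rewrite mxE (le_trans (ler_norm _))// normrM.
by rewrite ler_wpM2l// (bigD1 i)//= lerDl sumr_ge0.
Qed.

Lemma mx_entry_le m n (A : 'M[R]_(m, n)) i j : `|A i j| <= `|A|.
Proof.
rewrite [leRHS]/Num.norm/= mx_normrE.
exact: (le_bigmax _ (fun ij => `|A ij.1 ij.2|) (i, j)).
Qed.

Lemma norm2_mulmx_le m n (A : 'M[R]_(m, n)) (x : 'cV[R]_n) (c : R) :
  (forall i j, `|A i j| <= c) -> norm2 (A *m x) <= (m * n)%:R * c * norm2 x.
Proof.
move=> Ac; apply: le_trans (norm2_le_sum _) _.
have le1 i : `|(A *m x) i 0| <= n%:R * c * norm2 x.
  rewrite mxE (le_trans (ler_norm_sum _ _ _))//.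
  apply: (@le_trans _ _ (\sum_(j < n) c * norm2 x)); last first.
    by rewrite sumr_const card_ord -mulrA mulr_natl.
  apply: ler_sum => j _; rewrite normrM ler_pM//.
  exact: coord_le_norm2.
rewrite (le_trans (ler_sum _ (fun i _ => le1 i)))// sumr_const card_ord.
by rewrite natrM -!mulrA [leRHS]mulr_natl.
Qed.

Lemma norm2_le_norm n (x : 'cV[R]_n) : norm2 x <= n%:R * `|x|.
Proof.
rewrite (le_trans (norm2_le_sum _))//.
apply: (@le_trans _ _ (\sum_(i < n) `|x|)); last first.
  by rewrite sumr_const card_ord mulr_natl.
by apply: ler_sum => i _; exact: mx_entry_le.
Qed.

Lemma norm_le_norm2 n (x : 'cV[R]_n) : `|x| <= norm2 x.
Proof.
rewrite [leLHS]/Num.norm/= mx_normrE; apply: bigmax_le; first exact: norm2_ge0.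
by case=> i j _ /=; rewrite ord1 coord_le_norm2.
Qed.

(** The entries of A bound the set whose supremum is the operator norm, so the
    supremum is an upper bound; rescaling x to norm 1 does the rest. *)
Lemma norm2_mulmx_opnorm m n (A : 'M[R]_(m, n)) (x : 'cV[R]_n) :
  norm2 (A *m x) <= opnorm A * norm2 x.
Proof.
have le1 (y : 'cV[R]_n) : norm2 y <= 1 -> norm2 (A *m y) <= opnorm A.
  move=> y1; apply: ub_le_sup; last by exists y.
  exists ((m * n)%:R * `|A|) => _ [z /= z1 <-].
  rewrite (le_trans (norm2_mulmx_le _ (mx_entry_le A)))// -[leRHS]mulr1.
  by rewrite ler_wpM2l// mulr_ge0.
have [->|x0] := eqVneq x 0; first by rewrite mulmx0 !norm20 mulr0.
have nx : 0 < norm2 x by rewrite lt_def norm2_eq0 x0 norm2_ge0.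
have := le1 ((norm2 x)^-1 *: x).
rewrite -scalemxAr !norm2Z ger0_norm ?invr_ge0 ?norm2_ge0//.
rewrite mulVf ?gt_eqF// => /(_ (lexx _)).
by rewrite mulrC ler_pdivrMr.
Qed.

Lemma opnorm_ge0 m n (A : 'M[R]_(m, n)) : 0 <= opnorm A.
Proof.
have [[x x0]|nx] := pselect (exists x : 'cV[R]_n, x != 0).
  have nx : 0 < norm2 x by rewrite lt_def norm2_eq0 x0 norm2_ge0.
  rewrite -(pmulr_lge0 _ nx).
  exact: le_trans (norm2_ge0 _) (norm2_mulmx_opnorm A x).
(* In dimension zero the supremum is over the singleton {0}. *)
rewrite /opnorm [X in sup X](_ : _ = [set 0]) ?sup1//.
apply/seteqP; split=> [_ [x _ <-]|_ ->] /=; last first.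
  by exists 0; rewrite /= ?mulmx0 norm20.
have [->|x0] := eqVneq x 0; first by rewrite mulmx0 norm20.
by exfalso; apply: nx; exists x.
Qed.

Lemma entry_le_opnorm m n (A : 'M[R]_(m, n)) i j : `|A i j| <= opnorm A.
Proof.
have -> : A i j = (A *m (delta_mx j 0 : 'cV_n)) i 0.
  rewrite mxE (bigD1 j)//= mxE !eqxx mulr1 big1 ?addr0// => k kj.
  by rewrite mxE (negbTE kj) mulr0.
rewrite (le_trans (coord_le_norm2 _ _))//.
rewrite (le_trans (norm2_mulmx_opnorm _ _))// -[leRHS]mulr1.
rewrite ler_wpM2l ?opnorm_ge0// (le_trans (norm2_le_sum _))//.
rewrite (bigD1 j)//= mxE !eqxx normr1 big1 ?addr0// => k kj.
by rewrite mxE (negbTE kj) normr0.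
Qed.

Lemma trmx_mul_eq0 m n (K : 'M[R]_(m, n)) (x : 'cV[R]_n) :
  K^T *m (K *m x) = 0 -> K *m x = 0.
Proof.
move=> KKx; apply/eqP; rewrite -norm2_eq0 -[_ == 0](expf_eq0 _ 2%N) norm2_sqr.
by rewrite trmx_mul -mulmxA KKx mulmx0 mxE.
Qed.

End EuclideanNorm.
(** * Least squares solutions and exact LSQR *)

Section LeastSquares.
Context {R : realType}.

Lemma unitmx_inj n (M : 'M[R]_n) :
  (forall x : 'cV[R]_n, M *m x = 0 -> x = 0) -> M \in unitmx.
Proof.
move=> Minj; rewrite -unitmx_tr -row_free_unit; apply: inj_row_free => v vM.
apply: trmx_inj; rewrite trmx0; apply: Minj.
by rewrite -[M]trmxK -trmx_mul vM trmx0.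
Qed.

Section FullColumnRank.
Context {p n : nat} (K : 'M[R]_(p, n)).
Hypothesis Kinj : forall x : 'cV[R]_n, K *m x = 0 -> x = 0.

Lemma gram_unit : K^T *m K \in unitmx.
Proof.
by apply: unitmx_inj => x; rewrite -mulmxA => /trmx_mul_eq0; exact: Kinj.
Qed.

Lemma pinv_mulmx : pinv K *m K = 1%:M.
Proof. by rewrite /pinv -mulmxA mulVmx// gram_unit. Qed.

Lemma trmx_mul_pinv : K^T *m (K *m pinv K) = K^T.
Proof. by rewrite /pinv !mulmxA mulmxV ?mul1mx// gram_unit. Qed.

Lemma mulmx_pinv_sym : K *m pinv K = (pinv K)^T *m K^T.
Proof.
by rewrite /pinv trmx_mul trmxK trmx_inv trmx_mul trmxK !mulmxA.
Qed.

(** This is why the stopping ratio of LSQR vanishes at the least squares solution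
    and nowhere else. *)
Lemma normal_equation (d : 'cV[R]_p) (x : 'cV[R]_n) :
  K^T *m (K *m x - d) = 0 <-> x = pinv K *m d.
Proof.
split=> [|->]; last first.
  by rewrite mulmxBr (mulmxA K (pinv K)) (mulmxA K^T) trmx_mul_pinv subrr.
rewrite mulmxBr => /eqP; rewrite subr_eq0 mulmxA => /eqP e.
by rewrite /pinv -mulmxA -e mulKmx// gram_unit.
Qed.

(** Pythagoras: the residual of [pinv K *m d] is orthogonal to the range of K. *)
Lemma pinv_lsq (d : 'cV[R]_p) (z : 'cV[R]_n) :
  norm2 (K *m (pinv K *m d) - d) <= norm2 (K *m z - d).
Proof.
set x := pinv K *m d.
have Kx : K^T *m (K *m x - d) = 0 by apply/normal_equation.
have -> : K *m z - d = K *m (z - x) + (K *m x - d).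
  by rewrite mulmxBr addrA subrK.
rewrite norm2_le_sqr [leRHS]norm2D_sqr trmx_mul -(mulmxA _ K^T) Kx mulmx0.
rewrite mxE mul0rn addr0.
by rewrite lerDr sqr_ge0.
Qed.

End FullColumnRank.

Section Lsqr.
Context {p n : nat} (K : 'M[R]_(p, n)) (d : 'cV[R]_p).
Hypothesis Kinj : forall x : 'cV[R]_n, K *m x = 0 -> x = 0.

(** With a matrix B whose columns are a basis of V, this is the unconstrained
    problem for K B, which is again injective. *)
Lemma lsq_subspace_exists (V : {vspace 'cV[R]_n}) : exists x, x \in V /\
  forall z, z \in V -> norm2 (K *m x - d) <= norm2 (K *m z - d).
Proof.
pose B : 'M[R]_(n, \dim V) := \matrix_(i, j) (vbasis V)`_j i 0.
have BE (c : 'cV[R]_(\dim V)) : B *m c = \sum_j c j 0 *: (vbasis V)`_j.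
  apply/colP => i; rewrite mxE summxE; apply: eq_bigr => j _.
  by rewrite !mxE mulrC.
have Binj (c : 'cV[R]_(\dim V)) : (K *m B) *m c = 0 -> c = 0.
  rewrite -mulmxA => /Kinj; rewrite BE => c0; apply/colP => j.
  have /freeP/(_ (fun j => c j 0) c0 j) := basis_free (vbasisP V).
  by rewrite mxE.
exists (B *m (pinv (K *m B) *m d)); split=> [|z zV].
  rewrite BE; apply: rpred_sum => j _.
  by rewrite rpredZ ?vbasis_mem ?mem_nth ?size_tuple.
pose c := \col_j coord (vbasis V) j z.
have -> : z = B *m c.
  rewrite BE {1}(coord_vbasis zV); apply: eq_bigr => j _.
  by rewrite mxE.
by rewrite !(mulmxA K B); exact: pinv_lsq.
Qed.

(** By the parallelogram identity, two minimizers with different images under K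
    would have a midpoint with a smaller residual. *)
Lemma lsq_subspace_unique (V : {vspace 'cV[R]_n}) (x x' : 'cV[R]_n) :
  x \in V -> (forall z, z \in V -> norm2 (K *m x - d) <= norm2 (K *m z - d)) ->
  x' \in V -> (forall z, z \in V -> norm2 (K *m x' - d) <= norm2 (K *m z - d)) ->
  x = x'.
Proof.
move=> xV xmin x'V x'min.
apply/eqP; rewrite -subr_eq0; apply/eqP/Kinj/eqP; rewrite -norm2_eq0.
set a := K *m x - d; set b := K *m x' - d.
have ab : norm2 a = norm2 b by apply/eqP; rewrite eq_le xmin// x'min.
have mV : 2^-1 *: (x + x') \in V by rewrite rpredZ// rpredD.
have := xmin _ mV; rewrite -/a.
have -> : K *m (2^-1 *: (x + x')) - d = 2^-1 *: (a + b).
  rewrite -scalemxAr mulmxDr /a /b.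
  by apply/matrixP => i j; rewrite !mxE; lra.
have -> : K *m (x - x') = a - b.
  by rewrite mulmxBr /a /b opprB addrA subrK.
move: a b ab => a b ab.
rewrite norm2_le_sqr norm2Z exprMn norm2D_sqr real_normK ?num_real// -ab => le1.
have abE : norm2 (a - b) ^+ 2 = norm2 a ^+ 2 *+ 2 - (a^T *m b) 0 0 *+ 2.
  by rewrite norm2D_sqr norm2N -ab mulmxN [X in X *+ 2]mxE mulNrn mulr2n addrAC.
have := sqr_ge0 (norm2 (a - b)); rewrite -[_ == 0](expf_eq0 _ 2%N) abE.
by move: le1; set u := norm2 a ^+ 2; set w := (_ *m _) 0 0; lra.
Qed.

Lemma lsqr_iterate_exists i : exists x, lsqr_iterate K d i x.
Proof. exact: lsq_subspace_exists. Qed.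

Lemma lsqr_iterate_unique i x x' :
  lsqr_iterate K d i x -> lsqr_iterate K d i x' -> x = x'.
Proof.
move=> [xV xmin] [x'V x'min].
exact: (@lsq_subspace_unique (krylov K d i)).
Qed.

End Lsqr.

(** In exact arithmetic LSQR finds the least squares solution within n steps. *)
Lemma pinv_in_krylov p n (K : 'M[R]_(p, n)) (d : 'cV[R]_p) :
  (forall x : 'cV[R]_n, K *m x = 0 -> x = 0) -> pinv K *m d \in krylov K d n.
Proof.
case: n K => [|n'] K Kinj.
  by rewrite [X in X \in _](_ : _ = 0) ?mem0v//; apply/colP => -[].
set x := pinv K *m d; set G := K^T *m K.
have Gx : G *m x = K^T *m d 
  by rewrite -mulmxA (mulmxA K (pinv K)) (mulmxA K^T) trmx_mul_pinv.
(* The constant coefficient of the characteristic polynomial is invertible, so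
   the Cayley-Hamilton relation applied to x expresses x through G^l (G x). *)
have c0 : (char_poly G)`_0 != 0.
  rewrite char_poly_det mulf_neq0 ?signr_eq0//.
  by have := gram_unit Kinj; rewrite unitmxE unitfE.
have := congr1 (mulmx^~ x) (Cayley_Hamilton G).
rewrite mul0mx /= [char_poly G in LHS](_ : _ =
  \sum_(i < n'.+2) (char_poly G)`_i *: 'X^i); last first.
  by rewrite -[LHS]coefK size_char_poly poly_def.
rewrite linear_sum mulmx_suml big_ord_recl expr0 linearZ/= rmorph1.
rewrite -scalemxAl mul1mx => /eqP; rewrite addr_eq0 => /eqP xE.
rewrite -[x](scalerK c0) xE rpredZ// rpredN; apply: rpred_sum => i _.
rewrite linearZ/= rmorphXn/= horner_mx_X -scalemxAl rpredZ//.
apply: memv_span; apply/mapP; exists (i : nat); first by rewrite mem_iota ltn_ord.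
by rewrite /bump add1n exprSr -mulmxA Gx.
Qed.


Lemma pos_lower_bound (u : nat -> R) N :
  exists2 e, 0 < e & forall i, (i <= N)%N -> 0 < u i -> e <= u i.
Proof.
elim: N => [|N [e e0 IH]].
  exists (if 0 < u 0%N then u 0%N else 1); first by case: ifP.
  by move=> i; rewrite leqn0 => /eqP-> ->.
exists (if 0 < u N.+1 then Num.min e (u N.+1) else e).
  by case: ifP => // uN; rewrite lt_min e0.
move=> i; rewrite leq_eqVlt ltnS => /predU1P[->|iN] ui.
  by rewrite ui ge_min lexx orbT.
by case: ifP => _; rewrite ?ge_min IH.
Qed.

(** Only the iterates 0, ..., n matter, because iterate n is the solution and
    passes every test.  A tolerance that is at most every positive ratio among
    them rejects all iterates but the solution. *)
Lemma lsqr_exact p n (K : 'M[R]_(p, n)) (d : 'cV[R]_p) :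
  (forall x : 'cV[R]_n, K *m x = 0 -> x = 0) ->
  exists2 eps, 0 < eps & forall x, lsqr_output K d eps x <-> x = pinv K *m d.
Proof.
move=> Kinj.
have [X XP] := choice (@lsqr_iterate_exists _ _ K d Kinj).
pose ratio x : R := norm2 (K^T *m (K *m x - d)) / (norm2 (K *m x - d) * opnorm K).
have [eps eps0 epsP] := pos_lower_bound (ratio \o X) n.
exists eps => //.
have ratio0 x : ratio x = 0 -> x = pinv K *m d.
  (* The ratio also vanishes by division by zero, when the residual or K is zero;
     the solution is then found as well. *)
  move/eqP; rewrite mulf_eq0 invr_eq0 mulf_eq0 !norm2_eq0 orbA => /orP[|/eqP K0].
    move=> Kx; apply/normal_equation => //.
    by case/orP: Kx => /eqP// ->; rewrite mulmx0.
  apply/eqP; rewrite -subr_eq0; apply/eqP/Kinj/eqP; rewrite -norm2_eq0.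
  rewrite eq_le norm2_ge0 andbT.
  by rewrite (le_trans (norm2_mulmx_opnorm _ _))// K0 mul0r.
have ratio_ge0 x : 0 <= ratio x.
  by rewrite divr_ge0 ?mulr_ge0 ?norm2_ge0 ?opnorm_ge0.
have XnE : X n = pinv K *m d.
  apply: (lsqr_iterate_unique Kinj (XP n)); split; first exact: pinv_in_krylov.
  by move=> z _; exact: pinv_lsq.
have stop_exact : stopping_test K d eps (pinv K *m d).
  have /normal_equation e : pinv K *m d = pinv K *m d by [].
  by right; rewrite e// norm20 mul0r.
have stopE i x : (i <= n)%N -> lsqr_iterate K d i x ->
    stopping_test K d eps x -> x = pinv K *m d.
  move=> in_ xi [res0|xlt].
    by apply/normal_equation => //; rewrite res0 mulmx0.
  apply: ratio0; apply/eqP; rewrite eq_le ratio_ge0 andbT leNgt; apply/negP => x0.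
  have xX := lsqr_iterate_unique Kinj xi (XP i).
  by move: (epsP i in_); rewrite /= -xX => /(_ x0); rewrite leNgt xlt.
have outE x : lsqr_output K d eps x -> x = pinv K *m d.
  move=> [i [xi xstop first_]]; have [in_|ni] := leqP i n.
    exact: (stopE _ _ in_ xi xstop).
  by have := first_ _ _ ni (XP n); rewrite XnE => /(_ stop_exact).
move=> x; split=> [/outE//|->].
pose P i := `[< exists2 x, lsqr_iterate K d i x & stopping_test K d eps x >].
have Pn : P n by apply/asboolP; exists (X n); [exact: XP|rewrite XnE].
have [i /asboolP[x' x'i x'stop] imin] := ex_minnP (ex_intro P n Pn).
have x'out : lsqr_output K d eps x'.
  exists i; split=> // j z ji zj zstop.
  by have := imin j (asboolT (ex_intro2 _ _ z zj zstop)); rewrite leqNgt ji.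
by rewrite -(outE _ x'out).
Qed.

End LeastSquares.
(** * Limits of matrix-valued functions *)

Section MatrixLimits.
Context {R : realType} {T : Type} {F : set_system T} {FF : Filter F}.

Lemma cvg_mxP m n (f : T -> 'M[R]_(m, n)) (l : 'M[R]_(m, n)) :
  f x @[x --> F] --> l <-> forall i j, f x i j @[x --> F] --> l i j.
Proof.
split=> [fl i j|fl].
  exact: (cvg_comp f (fun M : 'M[R]_(m, n) => M i j) fl
    (@coord_continuous _ m n i j l)).
apply/cvgrPdist_le => e e0; near=> x.
rewrite [leLHS]/Num.Def.normr/= mx_normrE (bigmax_le _ (ltW e0))//= => i _.
rewrite !mxE; move: i; near: x; apply: filter_forall => /= i.
exact: ((cvgrPdist_le _ _).1 (fl i.1 i.2)).
Unshelve. all: by end_near. Qed.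

Lemma cvg_mulmx m n p (f : T -> 'M[R]_(m, n)) (g : T -> 'M[R]_(n, p))
  (a : 'M[R]_(m, n)) (c : 'M[R]_(n, p)) :
  f x @[x --> F] --> a -> g x @[x --> F] --> c ->
  (f x *m g x) @[x --> F] --> a *m c.
Proof.
move=> /cvg_mxP fa /cvg_mxP gc; apply/cvg_mxP => i j; rewrite mxE.
under eq_cvg do rewrite mxE.
apply: cvg_big => [|k _]; first exact: add_continuous.
exact: cvgM.
Qed.

Lemma cvg_trmx m n (f : T -> 'M[R]_(m, n)) (a : 'M[R]_(m, n)) :
  f x @[x --> F] --> a -> (f x)^T @[x --> F] --> a^T.
Proof.
move=> /cvg_mxP fa; apply/cvg_mxP => i j; rewrite mxE.
by under eq_cvg do rewrite mxE; exact: fa.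
Qed.

Lemma cvg_col_mx m n p (f : T -> 'M[R]_(m, n)) (g : T -> 'M[R]_(p, n))
  (a : 'M[R]_(m, n)) (c : 'M[R]_(p, n)) :
  f x @[x --> F] --> a -> g x @[x --> F] --> c ->
  col_mx (f x) (g x) @[x --> F] --> col_mx a c.
Proof.
move=> /cvg_mxP fa /cvg_mxP gc; apply/cvg_mxP => i j; rewrite mxE.
under eq_cvg do rewrite mxE.
by case: (fintype.split i) => k; [exact: fa|exact: gc].
Qed.

Lemma cvg_det n (f : T -> 'M[R]_n) (a : 'M[R]_n) :
  f x @[x --> F] --> a -> \det (f x) @[x --> F] --> \det a.
Proof.
move=> /cvg_mxP fa; rewrite /determinant.
apply: cvg_big => [|s _]; first exact: add_continuous.
apply: cvgM; first exact: cvg_cst.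
by apply: cvg_big => [|i _]; [exact: mul_continuous|exact: fa].
Qed.

(** By Cramer's rule the inverse is a continuous function of the entries where
    the determinant is nonzero. *)
Lemma cvg_invmx n (f : T -> 'M[R]_n) (a : 'M[R]_n) :
  a \in unitmx -> f x @[x --> F] --> a -> invmx (f x) @[x --> F] --> invmx a.
Proof.
rewrite unitmxE unitfE => a0 fa; rewrite /invmx [in X in _ --> X]unitmxE unitfE a0.
have fdet := cvg_det fa.
apply: (@cvg_trans _ ((\det (f x))^-1 *: \adj (f x) @[x --> F])).
  apply: near_eq_cvg; near=> x; rewrite unitmxE unitfE ifT//.
  by near: x; exact: cvgr_neq0 fdet a0.
apply: cvgZ; first exact: cvgV.
apply/cvg_mxP => i j; rewrite mxE /cofactor.
under eq_cvg do rewrite mxE /cofactor.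
apply: cvgM; first exact: cvg_cst.
apply: cvg_det; apply/cvg_mxP => k l; rewrite !mxE.
by under eq_cvg do rewrite !mxE; move/cvg_mxP: fa; exact.
Unshelve. all: by end_near. Qed.

End MatrixLimits.
(** * Derivative of the variable projection residual *)

Section ResidualDerivative.
Context {R : realType}.

Lemma proj_perp_mulmx p n (K : 'M[R]_(p, n)) :
  (forall x : 'cV[R]_n, K *m x = 0 -> x = 0) -> proj_perp K *m K = 0.
Proof.
by move=> Kinj; rewrite /proj_perp mulmxBl mul1mx -mulmxA pinv_mulmx// mulmx1 subrr.
Qed.

Lemma cvg_pinv {T : Type} {F : set_system T} {FF : Filter F} p n
    (f : T -> 'M[R]_(p, n)) (K : 'M[R]_(p, n)) :
  (forall x : 'cV[R]_n, K *m x = 0 -> x = 0) ->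
  f x @[x --> F] --> K -> pinv (f x) @[x --> F] --> pinv K.
Proof.
move=> Kinj fK; apply: cvg_mulmx; last exact: cvg_trmx.
apply: cvg_invmx; first exact: gram_unit.
by apply: cvg_mulmx => //; exact: cvg_trmx.
Qed.

(** An exact finite-difference form of the Golub-Pereyra formula.  The part of the
    increment orthogonal to the range of K comes from K' x' alone, as
    proj_perp K kills K; its projection on that range is (pinv K)^T K^T applied
    to it, where K^T r = 0 and K'^T r' = 0 for the two residuals r and r'. *)
Lemma residual_increment p n (K K' : 'M[R]_(p, n)) (d : 'cV[R]_p)
    (x := pinv K *m d) (x' := pinv K' *m d) :
  (forall x : 'cV[R]_n, K *m x = 0 -> x = 0) ->
  (forall x : 'cV[R]_n, K' *m x = 0 -> x = 0) ->
  (K' *m x' - d) - (K *m x - d) =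
  proj_perp K *m (K' - K) *m x' - (pinv K)^T *m (K' - K)^T *m (K' *m x' - d).
Proof.
move=> Kinj K'inj.
have e' : K'^T *m (K' *m x' - d) = 0 by apply/normal_equation.
have trB : (K' - K)^T = K'^T - K^T by rewrite linearB.
rewrite mulmxBr proj_perp_mulmx// subr0 trB (mulmxBr (pinv K)^T) -(mulmx_pinv_sym K).
rewrite (mulmxBl _ _ (_ - d)) -(mulmxA _ K'^T) e' mulmx0 sub0r opprK.
rewrite /proj_perp mulmxBl mul1mx mulmxBl -(mulmxA _ K' x').
rewrite [in X in _ = _ + X]mulmxBr [X in _ = _ + (_ - X)](_ : _ = K *m x).
  by rewrite opprB !addrA subrK addrC -!addrA addKr addrC.
by rewrite /x mulmxA.
Qed.

Lemma cvg_line (V : normedModType R) (y e : V) :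
  (t *: e + y) @[t --> (0 : R)^'] --> y.
Proof.
rewrite -[X in _ --> X]add0r -[X in _ --> X + _](scale0r e).
apply: cvg_within_filter; apply: cvgD; last exact: cvg_cst.
by apply: cvgZr_tmp; exact: cvg_id.
Qed.

Context {m n q r : nat} (A : 'cV[R]_r -> 'M[R]_(m, n)) (L : 'M[R]_(q, n)).
Context (b : 'cV[R]_m) (lambda : R).
Local Notation K := (Kmx A L lambda).
Local Notation f := (residual A L b lambda).
Local Notation d := (dvec q b).

Lemma residualE y : f y = K y *m (pinv (K y) *m d) - d.
Proof. by rewrite /residual /proj_perp mulmxBl mul1mx opprB mulmxA. Qed.

(** Divide [residual_increment] by t: since K' tends to K and [pinv] is continuous
    at K, only the difference quotient of K contributes to the limit. *)
Lemma residual_is_derive (y : 'cV[R]_r) j :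
  differentiable A y ->
  (\forall z \near y, forall x : 'cV[R]_n, K z *m x = 0 -> x = 0) ->
  is_derive y (delta_mx j 0 : 'cV[R]_r) f
    (proj_perp (K y) *m col_mx (partial j A y) (0 : 'M[R]_(q, n))
       *m (pinv (K y) *m d)
     - (pinv (K y))^T *m (col_mx (partial j A y) (0 : 'M[R]_(q, n)))^T *m f y).
Proof.
move=> Ady Kinj; set e := delta_mx j 0 : 'cV[R]_r; set K' := col_mx _ _.
have Kinj0 := nbhs_singleton Kinj.
have line := @cvg_line _ y e.
have Acvg : A (t *: e + y) @[t --> 0^'] --> A y.
  exact: (cvg_comp _ _ line (differentiable_continuous Ady)).
have Kcvg : K (t *: e + y) @[t --> 0^'] --> K y.
  by apply: cvg_col_mx => //; exact: cvg_cst.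
have Kquot : t^-1 *: (K (t *: e + y) - K y) @[t --> 0^'] --> K'.
  rewrite (_ : (fun t => _) = fun t =>
      col_mx (t^-1 *: (A (t *: e + y) - A y)) (0 : 'M[R]_(q, n))).
    apply: cvg_col_mx; last exact: cvg_cst.
    exact: (diff_derivable Ady).
  apply/funext => t; rewrite /Kmx opp_col_mx add_col_mx scale_col_mx subrr.
  by rewrite scaler0.
have xcvg : (pinv (K (t *: e + y)) *m d) @[t --> 0^'] --> pinv (K y) *m d.
  have pinvcvg : pinv (K (t *: e + y)) @[t --> 0^'] --> pinv (K y).
    exact: cvg_pinv.
  by apply: cvg_mulmx pinvcvg _; exact: cvg_cst.
have fcvg : f (t *: e + y) @[t --> 0^'] --> f y.
  rewrite residualE; under eq_cvg do rewrite residualE.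
  by apply: (cvgB (cvg_mulmx Kcvg xcvg)); exact: cvg_cst.
have fquot : t^-1 *: ((f \o shift y) (t *: e) - f y) @[t --> 0^'] -->
    proj_perp (K y) *m K' *m (pinv (K y) *m d) - (pinv (K y))^T *m K'^T *m f y.
  apply: (@cvg_trans _ ((proj_perp (K y) *m (t^-1 *: (K (t *: e + y) - K y))
       *m (pinv (K (t *: e + y)) *m d)
     - (pinv (K y))^T *m (t^-1 *: (K (t *: e + y) - K y))^T
       *m f (t *: e + y)) @[t --> 0^'])).
    apply: near_eq_cvg; near=> t.
    rewrite /= !residualE residual_increment//; last first.
      by near: t; exact: line Kinj.
    have trZ (M : 'M[R]_(m + q, n)) : (t^-1 *: M)^T = t^-1 *: M^T.
      by rewrite linearZ.
    by rewrite trZ -!scalemxAr -!scalemxAl -scalerBr.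
  apply: cvgB.
    exact: (cvg_mulmx (cvg_mulmx (cvg_cst _) Kquot) xcvg).
  exact: (cvg_mulmx (cvg_mulmx (cvg_cst _) (cvg_trmx Kquot)) fcvg).
split; first by apply/cvg_ex; eexists; exact: fquot.
exact: cvg_lim fquot.
Unshelve. all: by end_near. Qed.

(** The Jacobian that the method builds from an approximate solution is exact when
    the solution is. *)
Lemma jacmx_residual y :
  differentiable A y ->
  (\forall z \near y, forall x : 'cV[R]_n, K z *m x = 0 -> x = 0) ->
  approx_jac A L b lambda y (pinv (K y) *m d) = jacmx f y.
Proof.
move=> Ady Kinj; apply/matrixP => i j; rewrite [LHS]mxE [RHS]mxE /partial.
have [_ ->] := residual_is_derive j Ady Kinj.
congr (fun_of_matrix (_ + _) _ _); rewrite residualE tr_col_mx trmx0.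
have -> : K y *m (pinv (K y) *m d) - d =
    col_mx (A y *m (pinv (K y) *m d) - b) (lambda *: L *m (pinv (K y) *m d)).
  by rewrite /dvec {1}/Kmx mul_col_mx opp_col_mx add_col_mx subr0.
rewrite -[in RHS](mulmxA _ (row_mx _ _)) mul_row_col mul0mx addr0.
by rewrite -[in LHS](mulmxA (pinv _)^T) -[RHS]mulmxN -[in RHS]mulmxN opprB.
Qed.

End ResidualDerivative.
(** * Gradients, Jacobians and convexity *)

Section VectorCalculus.
Context {R : realType}.

Lemma norm2_sub_sqr n (x y : 'cV[R]_n) :
  norm2 x ^+ 2 - norm2 y ^+ 2 = ((x + y)^T *m (x - y)) 0 0.
Proof.
have -> : (x + y)^T = x^T + y^T by rewrite linearD.
rewrite mulmxDl !mulmxBr !norm2_sqr.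
have D (M N : 'M[R]_1) : (M + N) 0 0 = M 0 0 + N 0 0 by rewrite mxE.
have B (M N : 'M[R]_1) : (M - N) 0 0 = M 0 0 - N 0 0 by rewrite !mxE.
by rewrite D !B [(y^T *m x) 0 0]dotC addrA subrK.
Qed.

Lemma col_sum_delta n (v : 'cV[R]_n) : v = \sum_j v j 0 *: (delta_mx j 0 : 'cV[R]_n).
Proof.
rewrite [LHS]matrix_sum_delta; apply: eq_bigr => i _.
by rewrite big_ord_recl big_ord0 addr0.
Qed.

Lemma derive_jacmx r p (F : 'cV[R]_r -> 'cV[R]_p) (x v : 'cV[R]_r) :
  differentiable F x -> 'D_v F x = jacmx F x *m v.
Proof.
move=> dF; rewrite deriveE// [in LHS](col_sum_delta v) linear_sum.
apply/colP => i; rewrite summxE [RHS]mxE; apply: eq_bigr => j _.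
by rewrite linearZ !mxE /partial deriveE// mulrC.
Qed.

Lemma derive_grad r (g : 'cV[R]_r -> R) (x v : 'cV[R]_r) :
  differentiable (g : 'cV[R]_r -> R^o) x ->
  'D_v (g : 'cV[R]_r -> R^o) x = ((grad g x)^T *m v) 0 0.
Proof.
move=> dg; rewrite deriveE// [in LHS](col_sum_delta v) linear_sum.
rewrite [RHS]mxE; apply: eq_bigr => j _.
by rewrite linearZ !mxE /partial deriveE// mulrC.
Qed.

(** Differentiability refers to the max norm; passing to the Euclidean norm in
    the target costs a factor p, hence the division by p + 1 in the proof. *)
Lemma near_diff_le r p (F : 'cV[R]_r -> 'cV[R]_p) (x : 'cV[R]_r) (eta : R) :
  0 < eta -> differentiable F x ->
  \forall y \near x,
    norm2 (F y - F x - jacmx F x *m (y - x)) <= eta * norm2 (y - x).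
Proof.
move=> eta0 dF.
have eta'0 : 0 < eta / p.+1%:R by rewrite divr_gt0.
have /diff_locally/eqaddoP/(_ _ eta'0) oF := dF.
have sub : (y - x) @[y --> x] --> x - x.
  exact: (cvgB cvg_id (cvg_cst _)).
rewrite subrr in sub.
have oF' : \forall y \near x, `|F (y - x + x) - (F x + 'd F x (y - x))| <=
    eta / p.+1%:R * `|y - x|.
  exact: sub _ oF.
near=> y; set w := F (y - x + x) - (F x + 'd F x (y - x)).
have wle : `|w| <= eta / p.+1%:R * `|y - x| by rewrite /w; near: y.
have -> : F y - F x - jacmx F x *m (y - x) = w.
  by rewrite /w -derive_jacmx// deriveE// subrK opprD addrA.
rewrite (le_trans (norm2_le_norm _))//.
rewrite (le_trans (ler_wpM2l (ler0n _ _) wle))// mulrA ler_pM//.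
- by rewrite mulr_ge0// ltW.
- rewrite mulrCA -[leRHS]mulr1.
  by rewrite ler_wpM2l ?(ltW eta0)// ler_pdivrMr// mul1r ler_nat.
- exact: norm_le_norm2.
Unshelve. all: by end_near. Qed.

Lemma near_cvg_le T (F : set_system T) {FF : Filter F} m n
    (f : T -> 'M[R]_(m, n)) (a : 'M[R]_(m, n)) (eta : R) :
  0 < eta -> f x @[x --> F] --> a ->
  \forall x \near F, forall v, norm2 ((f x - a) *m v) <= eta * norm2 v.
Proof.
move=> eta0 fa.
have eta'0 : 0 < eta / (m * n).+1%:R by rewrite divr_gt0.
near=> x => v.
have fxa : `|a - f x| <= eta / (m * n).+1%:R.
  by near: x; exact: (cvgr_dist_le _ _ fa).
rewrite (le_trans (norm2_mulmx_le _ (c := eta / (m * n).+1%:R) _))//.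
  by move=> i j; rewrite (le_trans (mx_entry_le _ _ _))// distrC.
rewrite ler_wpM2r ?norm2_ge0// mulrCA -[leRHS]mulr1 ler_wpM2l ?(ltW eta0)//.
by rewrite ler_pdivrMr// mul1r ler_nat.
Unshelve. all: by end_near. Qed.

(** A one-sided bound on the increments suffices, the derivative being also the
    limit from the right. *)
Lemma derive_ge (V : normedModType R) (g : V -> R^o) (x v : V) (c : R) :
  derivable g x v ->
  (\forall t \near (0 : R)^'+, g x + t * c <= g (t *: v + x)) ->
  c <= 'D_v g x.
Proof.
move=> dg gc; have dgr := cvg_dnbhs_at_right dg.
rewrite /derive -(cvg_lim (@Rhausdorff R) dgr); apply: limr_ge.
  by apply/cvg_ex; eexists; exact: dgr.
near=> t; have t0 : 0 < t by near: t; exact: nbhs_right_gt.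
rewrite /= [leRHS](_ : _ = t^-1 * (g (t *: v + x) - g x))//.
rewrite ler_pdivlMl// lerBrDl.
by near: t.
Unshelve. all: by end_near. Qed.

Lemma derive_le (V : normedModType R) (g : V -> R^o) (x v : V) (c : R) :
  derivable g x v ->
  (\forall t \near (0 : R)^'+, g (t *: v + x) <= g x + t * c) ->
  'D_v g x <= c.
Proof.
move=> dg gc; rewrite -[c]opprK lerNr -deriveN//; apply: derive_ge.
  exact: derivableN.
by apply: filterS gc => t /=; rewrite !fctE mulrN -opprD lerN2.
Qed.

(** The derivative is nonnegative in every direction and in its opposite. *)
Lemma grad_min r (g : 'cV[R]_r -> R) (x : 'cV[R]_r) :
  differentiable (g : 'cV[R]_r -> R^o) x -> (\forall z \near x, g x <= g z) ->
  grad g x = 0.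
Proof.
move=> dg gmin; apply/colP => j; rewrite !mxE /partial; set e := delta_mx j 0.
have ge0 (v : 'cV[R]_r) : 0 <= 'D_v (g : 'cV[R]_r -> R^o) x.
  apply: derive_ge; first exact: diff_derivable.
  near=> t; rewrite mulr0 addr0; near: t.
  exact: (cvg_dnbhs_at_right (@cvg_line R _ x v) gmin).
apply/eqP; rewrite eq_le ge0 andbT -oppr_ge0.
by have := ge0 (- e); rewrite !deriveE// linearN.
Unshelve. all: by end_near. Qed.

(** Partial derivatives of f are enough: the increment of the squared norm is the
    inner product of f(x + te) + f(x) with the increment of f. *)
Lemma grad_half_norm2_sqr r p (f : 'cV[R]_r -> 'cV[R]_p) (x : 'cV[R]_r) :
  (forall j, derivable f x (delta_mx j 0)) ->
  grad (fun z => 2^-1 * norm2 (f z) ^+ 2) x = (jacmx f x)^T *m f x.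
Proof.
move=> df; apply/colP => j; rewrite [LHS]mxE /partial; set e := delta_mx j 0.
have fquot : t^-1 *: ((f \o shift x) (t *: e) - f x) @[t --> 0^'] --> 'D_e f x.
  exact: df.
have fcvg : f (t *: e + x) @[t --> 0^'] --> f x.
  have lim0 : t *: (t^-1 *: (f (t *: e + x) - f x)) + f x @[t --> 0^'] -->
      0 *: 'D_e f x + f x.
    apply: cvgD; last exact: cvg_cst.
    by apply: cvgZ => //; apply: cvg_within_filter; exact: cvg_id.
  rewrite scale0r add0r in lim0; apply: cvg_trans lim0.
  apply: near_eq_cvg; near=> t; rewrite scalerA mulfV ?scale1r ?subrK//.
  by near: t; exact: nbhs_dnbhs_neq.
apply: cvg_lim => //.
have -> : ((jacmx f x)^T *m f x) j 0 =
    2^-1 * ((f x + f x)^T *m 'D_e f x) 0 0.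
  have -> : (f x + f x)^T = 2 *: (f x)^T by rewrite -mulr2n -scaler_nat linearZ.
  rewrite -scalemxAl [X in _ = _ * X]mxE mulrA mulVf ?mul1r ?pnatr_eq0//.
  by rewrite mxE [RHS]mxE; apply: eq_bigr => k _; rewrite !mxE mulrC.
rewrite (_ : (fun t => _) = fun t => 2^-1 * ((f (t *: e + x) + f x)^T *m
    (t^-1 *: (f (t *: e + x) - f x))) 0 0); last first.
  apply/funext => t /=.
  rewrite -mulrBr norm2_sub_sqr -scalemxAr [X in _ = _ * X]mxE.
  by rewrite [LHS]mulrCA.
apply: cvgM; first exact: cvg_cst.
have lim0 : (f (t *: e + x) + f x)^T *m (t^-1 *: (f (t *: e + x) - f x))
    @[t --> 0^'] --> (f x + f x)^T *m 'D_e f x.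
  apply: cvg_mulmx => //; apply: cvg_trmx; apply: (cvgD fcvg); exact: cvg_cst.
exact: ((cvg_mxP _ _).1 lim0).
Unshelve. all: by end_near. Qed.

(** A convex function lies above its tangents, so its gradient is monotone along
    the line x + tv; differentiate v^T grad g (x + tv) at t = 0 from the right. *)
Lemma convex_hess_ge0 r (g : 'cV[R]_r -> R) (x v : 'cV[R]_r) :
  convex_function (setT : set (convex_lmodType 'cV[R]_r)) g ->
  (forall y, twice_differentiable_at g y) ->
  0 <= (v^T *m (hess g x *m v)) 0 0.
Proof.
move=> gconv g2.
have dg y : differentiable (g : 'cV[R]_r -> R^o) y.
  by have [/nbhs_singleton] := g2 y.
have tangent y z : ((grad g y)^T *m (z - y)) 0 0 <= g z - g y.
  rewrite -derive_grad//; apply: derive_le; first exact: diff_derivable.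
  near=> t.
  have t0 : 0 <= t by near: t; exact: nbhs_right_ge.
  have t1 : t <= 1 by near: t; exact: nbhs_right_le.
  have := gconv (Itv01 t0 t1) z y; rewrite !inE => /(_ I I).
  have -> : conv (Itv01 t0 t1) (z : convex_lmodType 'cV[R]_r) y
      = t *: (z - y) + y :> 'cV[R]_r.
    by rewrite /conv/= /unstable.onem scalerBl scale1r scalerBr addrA addrAC.
  rewrite convRE/= /unstable.onem => /le_trans->//.
  by rewrite mulrBl mul1r mulrBr; lra.
pose G z : R^o := (v^T *m grad g z) 0 0.
have [_ dgx] := g2 x.
have GD : is_derive x v G ((v^T *m (hess g x *m v)) 0 0).
  have quot : t^-1 *: ((G \o shift x) (t *: v) - G x) @[t --> 0^'] -->
      (v^T *m (hess g x *m v)) 0 0.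
    rewrite /hess -derive_jacmx//.
    have lim0 : v^T *m (t^-1 *: (grad g (t *: v + x) - grad g x))
        @[t --> 0^'] --> v^T *m 'D_v (grad g) x.
      apply: cvg_mulmx; first exact: cvg_cst.
      exact: (diff_derivable dgx).
    have lim1 := (cvg_mxP _ _).1 lim0 0 0.
    have quotE t : t^-1 *: ((G \o shift x) (t *: v) - G x) =
        (v^T *m (t^-1 *: (grad g (t *: v + x) - grad g x))) 0 0 :> R^o.
      rewrite /G /= -scalemxAr mulmxBr [RHS]mxE.
      by rewrite [X in _ = _ * X]mxE [X in _ = _ * (_ + X)]mxE.
    by under eq_cvg do rewrite quotE; exact: lim1.
  split; first by apply/cvg_ex; eexists; exact: quot.
  exact: cvg_lim quot.
rewrite -(@derive_val _ _ _ _ _ _ _ GD); apply: derive_ge.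
  exact: ex_derive.
near=> t; rewrite mulr0 addr0.
have t0 : 0 < t by near: t; exact: nbhs_right_gt.
have scale (w : 'cV[R]_r) (c : R) : (w^T *m (c *: v)) 0 0 = c * (v^T *m w) 0 0.
  by rewrite -scalemxAr mxE; congr (_ * _); exact: dotC.
have := tangent x (t *: v + x); rewrite addrK scale => le1.
have := tangent (t *: v + x) x; rewrite opprD addrCA subrr addr0 -scaleNr scale.
move=> le2; rewrite -(ler_pM2l t0) /G.
by lra.
Unshelve. all: by end_near. Qed.

(** H plays the part of an approximate Jacobian of G, of which only the defect at
    the root x has to be small.  Near x, |v| <= 2 c |H(y) v| with c the norm of
    the inverse of H(x), which gives both the invertibility of H(y) and, with the
    decomposition of H(y) (y' - x) below, the factor 2 c (2 eta + S) <= 1/2. *)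
Lemma newton_contraction r (H : 'cV[R]_r -> 'M[R]_r) (G : 'cV[R]_r -> 'cV[R]_r)
    (x : 'cV[R]_r) :
  G x = 0 -> differentiable G x -> H y @[y --> x] --> H x -> H x \in unitmx ->
  opnorm (invmx (H x)) * opnorm (H x - jacmx G x) < 32^-1 ->
  \forall y \near x, H y \in unitmx /\
    norm2 (y - invmx (H y) *m G y - x) <= 2^-1 * norm2 (y - x).
Proof.
move=> Gx0 dG Hcvg Hu small.
set c := opnorm (invmx (H x)) in small; set S := opnorm _ in small.
have c0 : 0 <= c := opnorm_ge0 _.
(* Adding 1 keeps eta positive when c = 0, that is in dimension zero. *)
pose eta := (16 * (c + 1))^-1.
have c1 : 0 < c + 1 by lra.
have eta0 : 0 < eta by rewrite invr_gt0 mulr_gt0.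
have ceta : c * eta <= 16^-1.
  rewrite /eta invfM mulrCA -[leRHS]mulr1 ler_wpM2l//.
  by rewrite ler_pdivrMr// mul1r; lra.
near=> y.
have HyE v : norm2 ((H y - H x) *m v) <= eta * norm2 v.
  by move: v; near: y; exact: near_cvg_le.
have GyE : norm2 (G y - G x - jacmx G x *m (y - x)) <= eta * norm2 (y - x).
  by near: y; exact: near_diff_le.
have lower v : norm2 v <= 2 * c * norm2 (H y *m v).
  have le1 : norm2 v <= c * norm2 (H x *m v).
    by rewrite -{1}[v](mulKmx Hu) norm2_mulmx_opnorm.
  have le2 : norm2 (H x *m v) <= norm2 (H y *m v) + eta * norm2 v.
    rewrite (le_trans _ (lerD (lexx _) (HyE v)))//.
    rewrite (le_trans _ (norm2B _ _))// -mulmxBl opprB addrCA subrr addr0.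
    by [].
  have := ler_wpM2l c0 le2; rewrite mulrDr mulrA.
  have := ler_wpM2r (norm2_ge0 v) ceta.
  have := norm2_ge0 v.
  by rewrite -[2 * c * _]mulrA; move: le1; set a := norm2 v; set t := c * norm2 _;
    set w := c * norm2 (H y *m v); lra.
have Hyu : H y \in unitmx.
  apply: unitmx_inj => v Hv; apply/eqP; rewrite -norm2_eq0 eq_le norm2_ge0.
  by rewrite (le_trans (lower v))// Hv norm20 mulr0.
split=> //; rewrite (le_trans (lower _))//.
have -> : H y *m (y - invmx (H y) *m G y - x) =
    (H y - H x) *m (y - x) + (H x - jacmx G x) *m (y - x)
    - (G y - G x - jacmx G x *m (y - x)).
  rewrite addrAC mulmxBr mulKVmx// Gx0 subr0 opprB !mulmxBl.
  by rewrite !addrA !subrK.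
set E := _ + _ - _.
have EE : norm2 E <= (2 * eta + S) * norm2 (y - x).
  rewrite (le_trans (norm2B _ _))// (le_trans (lerD (norm2D _ _) GyE))//.
  have := HyE (y - x); have := norm2_mulmx_opnorm (H x - jacmx G x) (y - x).
  rewrite -/S; lra.
have c20 : 0 <= 2 * c by rewrite mulr_ge0.
rewrite (le_trans (ler_wpM2l c20 EE))//.
rewrite mulrA ler_wpM2r ?norm2_ge0//.
have -> : 2 * c * (2 * eta + S) = 4 * (c * eta) + 2 * (c * S) by ring.
lra.
Unshelve. all: by end_near. Qed.

End VectorCalculus.
(** * The method as exact Gauss-Newton *)

Section GaussNewton.
Context {R : realType} {m n q r : nat}.
Context (A : 'cV[R]_r -> 'M[R]_(m, n)) (L : 'M[R]_(q, n)).
Context (b : 'cV[R]_m) (lambda : R) (Reg : 'cV[R]_r -> R).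
Local Notation K := (Kmx A L lambda).
Local Notation f := (residual A L b lambda).
Local Notation J := (jacmx f).

Definition gn_hess (y : 'cV[R]_r) : 'M[R]_r := (J y)^T *m J y + hess Reg y.

Definition gn_step (y : 'cV[R]_r) : 'cV[R]_r :=
  y - invmx (gn_hess y) *m ((J y)^T *m f y + grad Reg y).

Lemma Kmx_inj y : 0 < lambda ->
  null_space (A y) `&` null_space L = [set 0] ->
  forall x : 'cV[R]_n, K y *m x = 0 -> x = 0.
Proof.
move=> lambda0 null x; rewrite /Kmx mul_col_mx -col_mx0 => /eq_col_mx[Ax].
rewrite -scalemxAl => /eqP; rewrite scaler_eq0 gt_eqF//= => /eqP Lx.
have : (null_space (A y) `&` null_space L) x by split.
by rewrite null.
Qed.

Lemma iRGenVarPro_step_exact y : differentiable A y ->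
  (\forall z \near y, forall x : 'cV[R]_n, K z *m x = 0 -> x = 0) ->
  exists2 eps, 0 < eps &
    forall y', iRGenVarPro_step A L b lambda Reg eps y y' <->
      gn_hess y \in unitmx /\ y' = gn_step y.
Proof.
move=> Ady Kinj; have Kinj0 := nbhs_singleton Kinj.
have [eps eps0 epsP] := lsqr_exact (dvec q b) Kinj0.
exists eps => // y'; rewrite /gn_step /gn_hess -(jacmx_residual b Ady Kinj).
rewrite residualE; split=> [[x /epsP->]//|Hy'].
by exists (pinv (K y) *m dvec q b) => //; apply/epsP.
Qed.

(** v^T (J^T J + hess Reg) v = |J v|^2 + v^T (hess Reg) v forces J v = 0 on the
    kernel, and J is injective. *)
Lemma gn_hess_unit y : \rank (J y) = r ->
  (forall v : 'cV[R]_r, 0 <= (v^T *m (hess Reg y *m v)) 0 0) ->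
  gn_hess y \in unitmx.
Proof.
move=> rkJ psd; apply: unitmx_inj => v Hv.
have Jv0 : J y *m v = 0.
  apply/eqP; rewrite -norm2_eq0 -[_ == 0](expf_eq0 _ 2%N) eq_le sqr_ge0 andbT.
  rewrite norm2_sqr trmx_mul -mulmxA (mulmxA (J y)^T).
  have /(congr1 (fun w => (v^T *m w) 0 0)) := Hv.
  rewrite mulmxDl mulmxDr mulmx0 [LHS]mxE [RHS]mxE => /eqP.
  by rewrite addr_eq0 => /eqP->; rewrite oppr_le0.
have free : row_free (J y)^T by rewrite /row_free mxrank_tr rkJ.
apply: trmx_inj; apply: (row_free_inj free).
by rewrite -trmx_mul Jv0 !trmx0 mul0mx.
Qed.

End GaussNewton.

Lemma jacmxD (R : realType) r p (F G : 'cV[R]_r -> 'cV[R]_p) x :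
  differentiable F x -> differentiable G x ->
  jacmx (F + G) x = jacmx F x + jacmx G x.
Proof.
move=> dF dG; apply/matrixP => i j; rewrite !mxE /partial.
by rewrite deriveD ?mxE//; exact: diff_derivable.
Qed.

Lemma gradD (R : realType) r (g h : 'cV[R]_r -> R) x :
  differentiable (g : 'cV[R]_r -> R^o) x ->
  differentiable (h : 'cV[R]_r -> R^o) x ->
  grad (fun y => g y + h y) x = grad g x + grad h x.
Proof.
move=> dg dh; apply/colP => j; rewrite !mxE /partial.
by rewrite -deriveD//; exact: diff_derivable.
Qed.

Theorem theorem4p2 (R : realType) (m n q r : nat)
    (hnm : (n <= m)%N) (hrn : (r < n)%N)
    (A : 'cV[R]_r -> 'M[R]_(m, n)) (L : 'M[R]_(q, n)) (b : 'cV[R]_m)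
    (lambda : R) (hlambda : 0 < lambda)
    (Reg : 'cV[R]_r -> R)
    (Y Omega : set 'cV[R]_r) (ystar : 'cV[R]_r)
    (hA : forall y, Y y -> differentiable A y)
    (hnull : forall y, Y y -> null_space (A y) `&` null_space L = [set 0]) :
  let K := Kmx A L lambda in
  let f := residual A L b lambda in
  let J := jacmx f in
  let H := fun y => (J y)^T *m J y + hess Reg y in
  let phi := fun y => 2^-1 * norm2 (f y) ^+ 2 in
  let varphi := fun y => phi y + Reg y in
  forall (hmin : Y ystar /\ forall y, Y y -> varphi ystar <= varphi y)
    (hOmega : [/\ open Omega, Omega ystar & Omega `<=` Y])
    (M kappa gamma : R) (hM : 0 < M) (hkappa : 0 < kappa) (hgamma : 0 < gamma)
    (hbounds : forall y, Omega y ->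
      [/\ \big[Num.max/0]_(j < r) opnorm (partial j A y) <= M,
          cond2 (K y) <= kappa
        & gamma <= opnorm (K y)])
    (LJ : R) (hLJ : 0 < LJ)
    (hJrank : forall y, Omega y -> \rank (J y) = minn (m + q) r)
    (hJlip : forall y, Omega y ->
      opnorm (J y - J ystar) <= LJ * norm2 (y - ystar))
    (hRegconv : convex_function
       (setT : set (convex_lmodType 'cV[R]_r)) Reg)
    (hRegC2 : C2 Reg)
    (LReg : R)
    (hReglip : forall y, Omega y ->
      opnorm (hess Reg y - hess Reg ystar) <= LReg * norm2 (y - ystar))
    (hphi2 : twice_differentiable_at phi ystar)
    (hsmall : opnorm (invmx (H ystar))
              * opnorm ((J ystar)^T *m J ystar - hess phi ystar) < 32^-1),
  exists2 delta : R, 0 < delta &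
    forall y0 : 'cV[R]_r, norm2 (y0 - ystar) < delta ->
      exists eps : nat -> R,
        [/\ forall k, 0 < eps k,
            exists y : nat -> 'cV[R]_r, iRGenVarPro A L b lambda Reg eps y0 y
          & forall y : nat -> 'cV[R]_r,
              iRGenVarPro A L b lambda Reg eps y0 y ->
              forall k : nat, norm2 (y k - ystar) <= (2 ^+ k)^-1].
Proof.
move=> K f J H phi varphi [Yystar hmin] [Oopen Oystar OY] _ _ _ _ _ _ _.
move=> LJ LJ0 hJrank hJlip hRegconv [Reg2 hessRegcont] LReg _ [phid dgradphi] small.
have Onear y : Omega y -> \forall z \near y, Omega z.
  by move=> Oy; apply: open_nbhs_nbhs.
have Kinj y : Omega y ->
    \forall z \near y, forall x : 'cV[R]_n, K z *m x = 0 -> x = 0.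
  move=> Oy; near=> z; apply: Kmx_inj => //; apply: hnull; apply: OY.
  by near: z; exact: Onear.
have Ad y : Omega y -> differentiable A y by move=> Oy; apply: hA; exact: OY.
have gradphi y : Omega y -> grad phi y = (J y)^T *m f y.
  move=> Oy; apply: grad_half_norm2_sqr => j.
  by have [] := residual_is_derive b j (Ad _ Oy) (Kinj _ Oy).
have Regd y : differentiable (Reg : 'cV[R]_r -> R^o) y.
  by have [/nbhs_singleton] := Reg2 y.
have gradRegd : differentiable (grad Reg) ystar by have [] := Reg2 ystar.
have phidystar := nbhs_singleton phid.
pose G := grad phi + grad Reg.
have Gd : differentiable G ystar by exact: differentiableD.
have G0 : G ystar = 0.
  have <- : grad varphi ystar = G ystar by exact: gradD.
  apply: grad_min; first exact: differentiableD.
  near=> y; apply: hmin; apply: OY; near: y; exact: Onear.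
have Hunit : H ystar \in unitmx.
  apply: gn_hess_unit => [|v]; last exact: convex_hess_ge0.
  rewrite hJrank//; apply/minn_idPr.
  by rewrite (leq_trans (ltnW hrn))// (leq_trans hnm)// leq_addr.
have Jcvg : J y @[y --> ystar] --> J ystar.
  apply/(@cvg_mxP _ _ (nbhs ystar) _) => i j; apply/cvgrPdist_le => e e0; near=> y.
  have Oy : Omega y by near: y; exact: Onear.
  have mxB (B C : 'M[R]_(m + q, r)) : B i j - C i j = (B - C) i j by rewrite !mxE.
  rewrite distrC mxB (le_trans (entry_le_opnorm _ _ _))// (le_trans (hJlip _ Oy))//.
  rewrite mulrC -ler_pdivlMr// (le_trans (norm2_le_norm _))//.
  rewrite distrC.
  have /ltW : `|ystar - y| < e / LJ / r.+1%:R.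
    by near: y; apply: cvgr_dist_lt; [exact: cvg_id|rewrite !divr_gt0].
  rewrite ler_pdivlMr// mulrC; apply: le_trans.
  by rewrite ler_wpM2r// ler_nat.
have Hcvg : H y @[y --> ystar] --> H ystar.
  have JJcvg : ((J y)^T *m J y) @[y --> ystar] --> (J ystar)^T *m J ystar.
    exact: (cvg_mulmx (cvg_trmx Jcvg) Jcvg).
  exact: (cvgD JJcvg (hessRegcont ystar)).
have smallG : opnorm (invmx (H ystar)) * opnorm (H ystar - jacmx G ystar) < 32^-1.
  have -> : jacmx G ystar = hess phi ystar + hess Reg ystar by exact: jacmxD.
  have -> : H ystar - (hess phi ystar + hess Reg ystar) =
      (J ystar)^T *m J ystar - hess phi ystar.
    by rewrite opprD addrACA subrr addr0.
  exact: small.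
have good : \forall y \near ystar, Omega y /\ (H y \in unitmx /\
    norm2 (y - invmx (H y) *m G y - ystar) <= 2^-1 * norm2 (y - ystar)).
  near=> y; split; first by near: y; exact: Onear.
  by near: y; exact: newton_contraction.
(* Balls are for the max norm, which the Euclidean norm dominates. *)
have [e /= e0 eball] := (nbhs_ballP _ _).1 good.
pose ball2 y := norm2 (y - ystar) < Num.min e 1.
have step y : ball2 y -> norm2 (gn_step A L b lambda Reg y - ystar)
    <= 2^-1 * norm2 (y - ystar) /\ exists eps, 0 < eps /\
    forall y', iRGenVarPro_step A L b lambda Reg eps y y' <->
      y' = gn_step A L b lambda Reg y.
  rewrite /ball2 lt_min => /andP[ye _].
  have [] := eball y.
    rewrite -ball_normE /ball_/= distrC.
    exact: le_lt_trans (norm_le_norm2 _) ye.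
  move=> Oy [Hu contr]; split.
    by rewrite /gn_step -/(H y) -(gradphi _ Oy).
  have [eps eps0 epsP] := iRGenVarPro_step_exact b Reg (Ad _ Oy) (Kinj _ Oy).
  exists eps; split=> // y'; rewrite epsP; split=> [[]//|->]; split=> //.
exists (Num.min e 1); first by rewrite lt_min e0 ltr01.
move=> y0 y0ball.
pose ys k := iter k (gn_step A L b lambda Reg) y0.
have ysball k : ball2 (ys k) /\ norm2 (ys k - ystar) <= (2 ^+ k)^-1.
  elim: k => [|k [IHb IH]].
    split; first exact: y0ball.
    rewrite expr0 invr1 ltW// (lt_le_trans y0ball)//.
    by rewrite ge_min lexx orbT.
  have [contr _] := step _ IHb; split.
    apply: le_lt_trans contr _; apply: le_lt_trans _ IHb.
    by rewrite ler_piMl ?norm2_ge0// invf_le1// ler1n.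
  by rewrite (le_trans contr)// exprS invfM ler_wpM2l.
(* The k-th tolerance is the one that makes the step from the k-th Gauss-Newton
   iterate exact. *)
have [eps epsP] := choice (fun k => (step _ (ysball k).1).2).
exists eps; split=> [k||y [y00 yS] k].
- by have [] := epsP k.
- by exists ys; split=> // k; apply/(epsP k).2.
- suff -> : y k = ys k by have [] := ysball k.
  by elim: k => [//|k IH]; apply/(epsP k).2; rewrite -/(ys k) -IH.
Unshelve. all: by end_near. Qed.
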